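(* Let $(X,G)$ be a CR-dynamical system. Then both of the following hold. (1) $(X,G)$ is $1^{\ominus}$-minimal if and only if $(X,G)$ is $1^{\oplus}$-minimal. (2) $(X,G)$ is $1$-backward minimal if and only if $(X,G)$ is $1$-minimal.
   Context: A CR-dynamical system is a pair $(X,G)$ where $X$ is a compact metric space and $G\subseteq X\times X$ is a non-empty closed subset. $p_1(x,y)=x$ and $p_2(x,y)=y$ are the standard projections $X\times X\to X$, and $G^{-1}=\{(y,x):(x,y)\in G\}$. $A\subseteq X$ is $1$-invariant in $(X,G)$ if for each $x\in A$ with $x\in p_1(G)$ there is $y\in A$ such that $(x,y)\in G$; $A$ is $1$-backward invariant in $(X,G)$ if for each $y\in A$ with $y\in p_2(G)$ there is $x\in A$ such that $(x,y)\in G$. $(X,G)$ is $1$-minimal (respectively $1$-backward minimal) if every closed subset $A$ of $X$ that is $1$-invariant (respectively $1$-backward invariant) in $(X,G)$ satisfies $A\in\{\emptyset,X\}$. For a relation $R$ on $X$, $\star_{i=1}^{\infty}R=\{(x_1,x_2,x_3,\ldots)\in\prod_{i=1}^\infty X : (x_i,x_{i+1})\in R \text{ for each positive integer } i\}$, and $\pi_k$ denotes the $k$-th coordinate projection. For $x\in X$, $T_G^{+}(x)=\{\mathbf x\in\star_{i=1}^{\infty}G : \pi_1(\mathbf x)=x\}$ and $T_G^{-}(x)=\{\mathbf x\in\star_{i=1}^{\infty}G^{-1} : \pi_1(\mathbf x)=x\}$. For $\mathbf x\in\star_{i=1}^{\infty}G$, $\mathcal O_G^{\oplus}(\mathbf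 x)=\{\pi_k(\mathbf x): k\ge 1\}$; for $\mathbf x\in\star_{i=1}^{\infty}G^{-1}$, $\mathcal O_G^{\ominus}(\mathbf x)=\{\pi_k(\mathbf x): k\ge 1\}$. $\mathrm{Cl}$ denotes closure in $X$. $(X,G)$ is $1^{\oplus}$-minimal if $T_G^{+}(x)\ne\emptyset$ for each $x\in X$ and $\mathrm{Cl}(\mathcal O_G^{\oplus}(\mathbf x))=X$ for each $\mathbf x\in\star_{i=1}^{\infty}G$. $(X,G)$ is $1^{\ominus}$-minimal if $T_G^{-}(x)\ne\emptyset$ for each $x\in X$ and $\mathrm{Cl}(\mathcal O_G^{\ominus}(\mathbf x))=X$ for each $\mathbf x\in\star_{i=1}^{\infty}G^{-1}$. *)

(* Defs.v *)
From HB Require Import structures.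
From mathcomp Require Import all_boot all_order all_algebra.
From mathcomp Require Import all_classical all_reals all_analysis.

Set Implicit Arguments.
Unset Strict Implicit.
Unset Printing Implicit Defensive.

Local Open Scope classical_set_scope.

Definition CR_dynamical_system (R : realType) (X : metricType R)
    (G : set (X * X)) : Prop :=
  [/\ compact [set: X], G !=set0 & closed G].

(* [G.`1] and [G.`2] are the projections p_1(G) and p_2(G). *)
Definition one_invariant (X : Type) (G : set (X * X)) (A : set X) : Prop :=
  forall x, A x -> G.`1 x -> exists2 y, A y & G (x, y).

Definition one_backward_invariant (X : Type) (G : set (X * X)) (A : set X) :
    Prop :=
  forall y, A y -> G.`2 y -> exists2 x, A x & G (x, y).

Definition one_minimal (X : topologicalType) (G : set (X * X)) : Prop :=
  forall A : set X, closed A -> one_invariant G A -> A = set0 \/ A = [set: X].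

Definition one_backward_minimal (X : topologicalType) (G : set (X * X)) :
    Prop :=
  forall A : set X, closed A -> one_backward_invariant G A ->
    A = set0 \/ A = [set: X].

(* The infinite Mahavier product of H; sequences are indexed from 0, so the
   coordinate projection pi_k is evaluation at k - 1. *)
Definition mahavier_product (X : Type) (H : set (X * X)) : set (nat -> X) :=
  [set x | forall i, H (x i, x i.+1)].

Definition forward_trajectories (X : Type) (G : set (X * X)) (x : X) :
    set (nat -> X) :=
  [set s | mahavier_product G s /\ s 0%N = x].

Definition backward_trajectories (X : Type) (G : set (X * X)) (x : X) :
    set (nat -> X) :=
  [set s | mahavier_product (G^-1)%relation s /\ s 0%N = x].

(* The orbit, forward or backward, of a trajectory s is [range s]. *)
Definition one_oplus_minimal (X : topologicalType) (G : set (X * X)) : Prop :=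
  (forall x, forward_trajectories G x !=set0) /\
  (forall s, mahavier_product G s -> closure (range s) = [set: X]).

Definition one_ominus_minimal (X : topologicalType) (G : set (X * X)) : Prop :=
  (forall x, backward_trajectories G x !=set0) /\
  (forall s, mahavier_product (G^-1)%relation s ->
    closure (range s) = [set: X]).

(* Main.v *)
Require Import Defs.
From mathcomp Require Import all_boot all_order all_algebra.
From mathcomp Require Import all_classical all_reals all_analysis.

(** 1-minimality forces [p_1(G) = X] (a point outside [p_1(G)] is a closed
    1-invariant singleton), and the closure of a forward orbit is 1-invariant
    by compactness; hence 1-minimality and 1-oplus-minimality coincide.  Applied
    to [G^-1] this gives the backward versions, and it remains to pass from
    1-minimal to 1-backward minimal.  If [B] is closed, nonempty and 1-backward
    invariant, each of its points ends arbitrarily long paths inside [B]; so the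
    sets of points of [B] that start a path of length [n] inside [B] are
    nonempty, closed and decreasing in [n].  Their intersection is nonempty,
    closed, 1-invariant and contained in [B], so it is [X]. *)

Local Open Scope classical_set_scope.

Section ClosedRelation.
Context {X : topologicalType}.
Implicit Types (G : set (X * X)) (K : set X).

Lemma closed_relation_inv G : closed G -> closed (G^-1)%relation.
Proof.
by apply: (@preimage_closed _ _ (fun p : X * X => (p.2, p.1))) => p _;
  exact: swap_continuous.
Qed.

(** The set is the first projection of the part of [G] lying over [K], which is compact. *)
Lemma closed_relation_preimage G K :
  hausdorff_space X -> compact [set: X] -> closed G -> closed K ->
  closed [set x | exists2 y, K y & G (x, y)].
Proof.
move=> hX cX clG clK.
have -> : [set x | exists2 y, K y & G (x, y)] =
    fst @` (G `&` snd @^-1` K).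
  apply/seteqP; split => [x [y Ky Gxy]|_ [[x y] [Gxy Ky] <-]] /=.
    by exists (x, y).
  by exists y.
apply: (compact_closed hX); apply: continuous_compact.
  by apply: continuous_subspaceT => p; exact: cvg_fst.
apply: (subclosed_compact _ (compact_setX cX cX)) => //.
apply: closedI => //; apply: preimage_closed => // p _; exact: cvg_snd.
Qed.

Lemma closed_relation_image G x :
  hausdorff_space X -> compact [set: X] -> closed G ->
  closed [set y | G (x, y)].
Proof.
move=> hX cX clG.
have := @closed_relation_preimage (G^-1)%relation [set x] hX cX.
have -> : [set y | exists2 z, [set x] z & (G^-1)%relation (y, z)] =
    [set y | G (x, y)].
  by apply/seteqP; split => [y [_ -> ]|y Gxy] //; exists x.
apply; [exact: closed_relation_inv|].
exact: (compact_closed hX (@compact_set1 _ x)).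
Qed.

(** Pick [u n] in [F n]; a cluster point of [u] lies in each closed [F m], since [u] stays in [F m]
    from [m] on. *)
Lemma nested_closed_nonempty (F : nat -> set X) :
  compact [set: X] -> (forall n, closed (F n)) ->
  (forall n, F n.+1 `<=` F n) -> (forall n, F n !=set0) ->
  \bigcap_n F n !=set0.
Proof.
move=> cX clF decF /choice[u Fu].
have FS m n : (m <= n)%N -> F n `<=` F m.
  elim: n => [|n IHn]; first by rewrite leqn0 => /eqP ->.
  rewrite leq_eqVlt => /orP[/eqP -> //|/IHn FnFm].
  exact: subset_trans (decF n) FnFm.
have [|p [_ clp]] := cX (u @ \oo); first exact: filterT.
exists p => m _; apply: clF => B pB; apply: clp => //.
by exists m => // n /= /FS; apply; exact: Fu.
Qed.

Lemma trajectory_in {T : Type} (H : set (T * T)) (A : set T) x :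
  A x -> (forall z, A z -> exists2 y, A y & H (z, y)) ->
  exists2 s, forward_trajectories H x s & range s `<=` A.
Proof.
move=> Ax stepA.
have /choice[f fP] : forall z, exists y, A z -> A y /\ H (z, y).
  (* Off [A] the value is arbitrary: iterates of [x] never leave [A]. *)
  move=> z; have [Az|nAz] := pselect (A z); last by exists z.
  by have [y Ay Hzy] := stepA z Az; exists y.
have As n : A (iter n f x) by elim: n => //= n /fP[].
exists (fun n => iter n f x); last by move=> _ [n _ <-].
by split => // n; case: (fP _ (As n)).
Qed.

Lemma one_minimal_total G :
  hausdorff_space X -> G !=set0 -> one_minimal G -> forall x, G.`1 x.
Proof.
move=> hX [[a b] Gab] minG x; apply: contrapT => nGx.
have [|_ -> //|x0|xT] := minG [set x].
- exact: (compact_closed hX (@compact_set1 _ x)).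
- by have : [set x] x by []; rewrite x0.
- have : [set: X] a by [].
  by rewrite -xT => ax; apply: nGx; exists b; rewrite -ax.
Qed.

Lemma one_oplus_minimalP G :
  hausdorff_space X -> compact [set: X] -> closed G -> G !=set0 ->
  one_oplus_minimal G <-> one_minimal G.
Proof.
move=> hX cX clG G0; split=> [[trajG denseG] A clA invA|minG].
  have [->|/set0P[x Ax]] := eqVneq A set0; [by left|right].
  have [|s [Gs _] sA] := @trajectory_in X G A x Ax.
    move=> z Az; apply: invA => //.
    by have [t [Gt <-]] := trajG z; exists (t 1%N); exact: Gt.
  apply/seteqP; split=> // z _; apply: clA.
  by apply: (closureS sA); rewrite (denseG s Gs).
have totG := one_minimal_total G hX G0 minG.
split=> [x|s Gs].
  have [//|z _|s Gs _] := @trajectory_in X G [set: X] x; last by exists s.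
  by have [y Gzy] := totG z; exists y.
have [| |cl0|//] := minG (closure (range s)); first exact: closed_closure.
- move=> x clx _.
  (* The points with a successor in the orbit closure form a closed set; it contains the orbit,
     hence also its closure. *)
  have /(_ x) := @closed_relation_preimage G _ hX cX clG
    (@closed_closure _ (range s)).
  apply; apply: closureS clx => _ [n _ <-].
  by exists (s n.+1); [apply: subset_closure; exists n.+1|exact: Gs].
- have : closure (range s) (s 0%N) by apply: subset_closure; exists 0%N.
  by rewrite cl0.
Qed.

(** Recursion on the first step makes each level the trace on [B] of a preimage under [G], hence
    closed. *)
Fixpoint path_start G (B : set X) (n : nat) : set X :=
  if n is n'.+1 then B `&` [set x | exists2 y, path_start G B n' y & G (x, y)]
  else B.

Lemma one_minimal_backward G :
  hausdorff_space X -> compact [set: X] -> closed G -> G !=set0 ->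
  one_minimal G -> one_backward_minimal G.
Proof.
move=> hX cX clG G0 minG B clB invB.
(* The image of [G] is closed, nonempty and 1-invariant, so it is [X]. *)
have surjG y : G.`2 y.
  have [| |G20|G2T] := minG [set y | exists2 x, [set: X] x & G (x, y)].
  - apply: (@closed_relation_preimage (G^-1)%relation) => //.
    exact: closed_relation_inv.
  - by move=> x _ [z Gxz]; exists z => //; exists x.
  - case: G0 => [[a b] Gab].
    have : [set y | exists2 x, [set: X] x & G (x, y)] b by exists a.
    by rewrite G20.
  - have : [set: X] y by [].
    by rewrite -G2T => -[x _ Gxy]; exists x.
have [->|/set0P B0] := eqVneq B set0; [by left|right].
pose P := path_start G B.
have PB n x : P n x -> B x by case: n => // n [].
have clP n : closed (P n).
  by elim: n => //= n IHn; apply: closedI => //; exact: closed_relation_preimage.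
have decP n : P n.+1 `<=` P n.
  elim: n => [|n IHn] x; first by case.
  by case=> Bx [y /IHn Py Gxy]; split=> //; exists y.
have P0 n : P n !=set0.
  elim: n => [//|n [y Py]].
  (* A path in [B] from [y] is lengthened at its start by a predecessor of [y] in [B]. *)
  have [x Bx Gxy] := invB y (PB _ _ Py) (surjG y).
  by exists x; split=> //; exists y.
have [| |I0|IT] := minG (\bigcap_n P n); first by apply: closed_bigI.
- move=> x Px _.
  (* One successor of [x] must serve for all [n]: membership of [x] in [P n.+1] gives one in [P n],
     and compactness a common one. *)
  have [| | |y Iy] := @nested_closed_nonempty
    (fun n => P n `&` [set y | G (x, y)]) cX.
  + by move=> n; apply: closedI => //; exact: closed_relation_image.
  + by move=> n y [/decP].
  + by move=> n; have [_ [y Py Gxy]] := Px n.+1 I; exists y.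
  + by exists y => [n _|]; [case: (Iy n I)|case: (Iy 0%N I)].
- by have [x] := nested_closed_nonempty P cX clP decP P0; rewrite I0.
- apply/seteqP; split=> // x; rewrite -IT => /(_ 0%N I); exact: PB.
Qed.

End ClosedRelation.

Theorem theorem7p10 (R : realType) (X : metricType R) (G : set (X * X))
    (hG : CR_dynamical_system G) :
  (one_ominus_minimal G <-> one_oplus_minimal G) /\
  (one_backward_minimal G <-> one_minimal G).
Proof.
have [cX G0 clG] := hG.
have hX : hausdorff_space X := @metric_hausdorff R X.
pose G' := (G^-1)%relation.
have G'0 : G' !=set0 by have [[a b] Gab] := G0; exists (b, a).
have clG' : closed G' := closed_relation_inv _ clG.
have backE : one_backward_minimal G <-> one_minimal G.
  split; last exact: one_minimal_backward.
  (* By conversion, the backward notions for [G] are the forward ones for [G'], and vice versa. *)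
  have := @one_minimal_backward X G' hX cX clG' G'0; exact.
split=> //.
apply: (iff_trans (one_oplus_minimalP G' hX cX clG' G'0)).
apply: (iff_trans backE); apply: iff_sym; exact: one_oplus_minimalP.
Qed.
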